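(* Let $(E,\lambda)$ be a connectivity system and $k\in\mathbb{N}$. Let $\Phi'$ be a $k$-pseudoflower which can be concatenated into a finite $k$-anemone $\Phi$ with at least $k+1$ many petals. Then $\Phi'$ is a strong $k$-pseudoanemone.
   Context: $\mathbb{N}$ contains $0$; expressions such as $k-1$ are taken in $\mathbb{Z}$. A connectivity system is a (possibly infinite) set $E$ with a map $\lambda:2^E\to\mathbb{N}\cup\{\infty\}$ such that for all $A,B\subseteq E$: $\lambda(A)=\lambda(E\setminus A)$, $\lambda(A)+\lambda(B)\geq\lambda(A\cup B)+\lambda(A\cap B)$, and $\lambda$ is limit-closed: if $n\in\mathbb{N}$ and $(A_i)_{i\in I}$ is a (non-empty) chain with respect to inclusion of subsets of $E$ with $\lambda(A_i)\le n$ for all $i$, then $\lambda(\bigcup_{i}A_i)\leq n$. The value $\lambda(A)$ is the order of $A$. A cyclic order on a set $I$ is a total strict cyclic order; $]x,y[$ is the set of elements strictly between $x$ and $y$ when going from $x$ to $y$. An interval of $I$ is a subset $Y\subseteq I$ such that for all distinct $x,z\in Y$ at least one of $]x,z[$ and $]z,x[$ is contained in $Y$; it is non-trivial if $Y\notin\{\emptyset,I\}$. A $k$-pseudoflower is a partition $(P_i)_{i\in I}$ of $E$ (into non-empty classes, called petals) with a cyclically ordered index set $I$ such that the union of any interval of partition classes has order at most $k-1$. A concatenation of a $k$-pseudoflower $(P_i)_{i\in I}$ is a $k$-pseudoflower $(Q_i)_{i\in I'}$ such that for every $i\in I$ there is $f(i)\in I'$ with $P_i\subseteq Q_{f(i)}$,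 and such that for all intervals $I''$ of $I'$ the set $f^{-1}(I'')$ is an interval of $I$. A $k$-flower is a $k$-pseudoflower with at least four petals in which the union of any non-trivial interval of petals has order exactly $k-1$. A finite $k$-anemone is a $k$-flower with finitely many petals in which all non-trivial unions of petals (unions of a non-empty proper subset of the petals) have order $k-1$. A strong $k$-pseudoanemone is a $k$-pseudoflower for which all unions of petals have order at most $k-1$. *)

(* Defs.v *)
From mathcomp Require Import all_boot all_order all_algebra.
From mathcomp Require Import boolp classical_sets cardinality constructive_ereal.

Set Implicit Arguments.
Unset Strict Implicit.
Unset Printing Implicit Defensive.

Local Open Scope classical_set_scope.
Local Open Scope card_scope.
Local Open Scope ring_scope.
Local Open Scope ereal_scope.

(* The codomain N u {oo} is the nonnegative part of \bar int; the ambient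
   integers give k - 1 its meaning also for k = 0. *)
Record connectivity_system (E : Type) := ConnectivitySystem {
  lambda :> set E -> \bar int ;
  lambda_ge0 : forall A, 0 <= lambda A ;
  lambda_setC : forall A, lambda (~` A) = lambda A ;
  lambda_submod : forall A B,
    lambda (A `|` B) + lambda (A `&` B) <= lambda A + lambda B ;
  lambda_limit : forall (n : nat) (F : set (set E)),
    F !=set0 -> total_on F (fun A B => A `<=` B) ->
    (forall A, F A -> lambda A <= n%:Z%:E) ->
    lambda (\bigcup_(A in F) A) <= n%:Z%:E }.

(* [cyc x y z] : going from x one meets y strictly before z. *)
Record cyclic_order (I : Type) := CyclicOrder {
  cyc :> I -> I -> I -> Prop ;
  cyc_rot : forall x y z, cyc x y z -> cyc y z x ;
  cyc_asym : forall x y z, cyc x y z -> ~ cyc z y x ;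
  cyc_trans : forall x y z t, cyc x y z -> cyc x z t -> cyc x y t ;
  cyc_total : forall x y z, x <> y -> y <> z -> x <> z ->
    cyc x y z \/ cyc z y x }.

Definition cyc_between I (C : cyclic_order I) (x z : I) : set I :=
  [set y | C x y z].

Definition cyc_interval I (C : cyclic_order I) (Y : set I) : Prop :=
  forall x z, Y x -> Y z -> x <> z ->
    cyc_between C x z `<=` Y \/ cyc_between C z x `<=` Y.

Definition nontrivial_subset I (Y : set I) : Prop := Y <> set0 /\ Y <> setT.

Definition petal_union E I (P : I -> set E) (Y : set I) : set E :=
  \bigcup_(i in Y) P i.

Section Flowers.
Variables (E : Type) (L : connectivity_system E) (k : nat).

Definition pseudoflower I (C : cyclic_order I) (P : I -> set E) : Prop :=
  partition [set: I] P [set: E] /\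
  forall Y, cyc_interval C Y -> L (petal_union P Y) <= (k%:Z - 1)%:E.

Definition concatenation I (C : cyclic_order I) (P : I -> set E)
    J (D : cyclic_order J) (Q : J -> set E) : Prop :=
  [/\ pseudoflower C P, pseudoflower D Q &
      exists f : I -> J, (forall i, P i `<=` Q (f i)) /\
        forall Y, cyc_interval D Y -> cyc_interval C (f @^-1` Y)].

Definition flower I (C : cyclic_order I) (P : I -> set E) : Prop :=
  [/\ pseudoflower C P, [set: 'I_4] #<= [set: I] &
      forall Y, cyc_interval C Y -> nontrivial_subset Y ->
        L (petal_union P Y) = (k%:Z - 1)%:E].

Definition finite_anemone I (C : cyclic_order I) (P : I -> set E) : Prop :=
  [/\ flower C P, finite_set [set: I] &
      forall Y, nontrivial_subset Y -> L (petal_union P Y) = (k%:Z - 1)%:E].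

Definition strong_pseudoanemone I (C : cyclic_order I) (P : I -> set E) : Prop :=
  pseudoflower C P /\ forall Y, L (petal_union P Y) <= (k%:Z - 1)%:E.

End Flowers.

(* Main.v *)
Require Import Defs.
From mathcomp Require Import all_boot all_order all_algebra.
From mathcomp Require Import boolp classical_sets cardinality constructive_ereal.
From mathcomp Require Import functions zify.

Set Implicit Arguments.
Unset Strict Implicit.
Unset Printing Implicit Defensive.

Import Order.TTheory GRing.Theory Num.Theory.

Local Open Scope classical_set_scope.
Local Open Scope card_scope.

(** Contract every petal [P i] to a point: the orders of unions of petals form a
    connectivity system [g] on the index set [I] ([petal_system]), and the
    concatenation becomes a map [f : I -> J] whose fibers are cyclic intervals.
    With [n = k - 1], intervals have [g]-order at most [n], and preimages of
    non-trivial subsets of [J] have order exactly [n]. The claim is that every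
    subset of [I] has order at most [n]. Up to the counting step,
    submodularity is applied to two sets of order at most [n]: if one of their union and intersection is the
    preimage of a non-trivial subset of [J], the other has order at most [n]
    ([uncrossU], [uncrossI]).

    Cutting one fiber ([fiber_arc_le], [fiber_petal_le]). Fix a petal [x] and a
    class [c <> f x]. The fiber of [x] is the union of its two arcs that start
    at [x] in either direction, and these arcs meet only in [x]. An interval
    that starts at [x] and runs to the end of another fiber consists of one of
    these arcs and a union of fibers; as [J] has at least four elements, the
    end can be chosen so that uncrossing replaces those fibers by the fiber of
    [c] alone. So the fiber of [c] together with either arc has order at most
    [n], and intersecting the two gives the same for the fiber of [c] together
    with [x].

    Absorbing ([superset_fiber_le]). Sets that contain the fiber of [c], whose
    order is exactly [n], can be enlarged one petal at a time by [uncrossU],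
    and along chains by limit-closedness. By Zorn's lemma every superset of a
    fiber has order at most [n], and so, by complementation, has every set that
    avoids a fiber.

    Counting ([all_unions_le]). Suppose that [g Y > n]. Removing the fiber of
    any one class from [Y] lowers its order, since the result avoids a fiber.
    By submodularity, adding the part of [Y] in a new fiber to the part of [Y]
    in other fibers therefore raises the order by at least 1. So the part of
    [Y] in [k] fibers has order at least [k]. As there are at least [k + 1]
    fibers, this part still avoids one of them and has order at most [k - 1], a
    contradiction. *)

(** * Cyclic orders *)

Section CyclicOrders.
Variables (I : Type) (C : cyclic_order I).

Lemma cyc_rot1 x y z : C x y z -> C y z x.
Proof. by move=> h; apply: cyc_rot. Qed.

Lemma cyc_rot2 x y z : C x y z -> C z x y.
Proof. by move=> h; apply/cyc_rot/cyc_rot. Qed.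

Lemma cyc_neq13 x y : ~ C x y x.
Proof. by move=> h; exact: (cyc_asym h). Qed.

Lemma cyc_neq12 x y : ~ C x x y.
Proof. by move=> h; exact: (cyc_neq13 (cyc_rot1 h)). Qed.

Lemma cyc_neq23 x y : ~ C x y y.
Proof. by move=> h; exact: (cyc_neq13 (cyc_rot2 h)). Qed.

(** Cutting the cyclic order open at [x] leaves a linear order in which [u]
    precedes [v] when [C x u v]; here [w] lies between [u] and [v]. *)
Lemma cyc_between_sub x u w v : C x u v -> C u w v -> C x w v.
Proof.
move=> /cyc_rot2 vxu /cyc_rot2 vuw.
by apply: cyc_rot; apply: (cyc_trans vxu vuw).
Qed.

(** Reversal has the same intervals, so each statement on arcs in one direction
    also holds in the other. *)
Definition cyc_rev : cyclic_order I.
Proof.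
exists (fun x y z => C z y x).
- by move=> x y z; exact: cyc_rot2.
- by move=> x y z; exact: cyc_asym.
- move=> x y z t /cyc_rot2 xzy /cyc_rot2 xtz.
  by apply: cyc_rot; exact: (cyc_trans xtz xzy).
- by move=> x y z xy yz xz; rewrite or_comm; exact: cyc_total.
Defined.

(** Read linearly from [x] on, sets containing [x] and closed under going back
    towards [x] are arcs starting at [x]. *)
Lemma initial_segment_interval x (A : set I) : A x ->
  (forall w v, A v -> C x w v -> A w) -> cyc_interval C A.
Proof.
move=> Ax Adown u v Au Av uv.
have [ux|ux] := pselect (x = u).
  by left=> w; rewrite -ux => /(Adown _ _ Av).
have [vx|vx] := pselect (x = v).
  by right=> w; rewrite -vx => /(Adown _ _ Au).
have [xuv|vux] := cyc_total C ux uv vx.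
  by left=> w /(cyc_between_sub xuv)/(Adown _ _ Av).
right=> w wvu; apply: (Adown w u Au).
by apply: (cyc_between_sub _ wvu); exact: cyc_rot2.
Qed.

(** An interval that avoids [x] is convex in the linear order obtained by cutting
    at [x]: the arc from [v] back to [u] passes through [x]. *)
Lemma interval_convex (K : set I) x u w v : cyc_interval C K ->
  ~ K x -> K u -> K v -> C x u w -> C x w v -> K w.
Proof.
move=> Kint Kx Ku Kv xuw xwv.
have xuv := cyc_trans xuw xwv.
have uv : u <> v by move=> uv; move: xuv; rewrite uv; exact: cyc_neq23.
have [uvK|vuK] := Kint u v Ku Kv uv.
  by apply: uvK; apply: cyc_rot2; exact: (cyc_trans (cyc_rot xwv) (cyc_rot2 xuw)).
by case: Kx; apply: vuK; exact: cyc_rot2.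
Qed.

End CyclicOrders.

Lemma cyc_interval_rev I (C : cyclic_order I) (Y : set I) :
  cyc_interval (cyc_rev C) Y -> cyc_interval C Y.
Proof. by move=> Yint x z Yx Yz xz; rewrite or_comm; exact: Yint. Qed.

Lemma cyc_interval_revr I (C : cyclic_order I) (Y : set I) :
  cyc_interval C Y -> cyc_interval (cyc_rev C) Y.
Proof. by move=> Yint x z Yx Yz xz; rewrite or_comm; exact: Yint. Qed.

(** * Connectivity systems *)

Section Uncrossing.
Variables (I : Type) (g : connectivity_system I) (n : nat).
Local Open Scope ereal_scope.

Lemma uncrossU A B : g A <= n%:Z%:E -> g B <= n%:Z%:E ->
  n%:Z%:E <= g (A `&` B) -> g (A `|` B) <= n%:Z%:E.
Proof.
have := lambda_submod g A B; move: (g A) (g B) (g (A `&` B)) (g (A `|` B)).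
case=> [a||] [b||] [c||] [d||] //=; rewrite -?EFinD ?lee_fin; lia.
Qed.

Lemma uncrossI A B : g A <= n%:Z%:E -> g B <= n%:Z%:E ->
  n%:Z%:E <= g (A `|` B) -> g (A `&` B) <= n%:Z%:E.
Proof.
have := lambda_submod g A B; move: (g A) (g B) (g (A `&` B)) (g (A `|` B)).
case=> [a||] [b||] [c||] [d||] //=; rewrite -?EFinD ?lee_fin; lia.
Qed.

(** Diminishing returns: [B] falls short of [A `|` B] by at least 1, so [A `&` B]
    falls short of [A] by at least 1. *)
Lemma submod_step m A B : ~~ (g (A `|` B) <= n%:Z%:E) -> g B <= n%:Z%:E ->
  m%:Z%:E <= g (A `&` B) -> m.+1%:Z%:E <= g A.
Proof.
have := lambda_submod g A B; have := lambda_ge0 g B.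
move: (g A) (g B) (g (A `&` B)) (g (A `|` B)).
case=> [a||] [b||] [c||] [d||] //=; rewrite -?EFinD ?lee_fin ?leey //; lia.
Qed.

(** Adding a point to [B `|` Z] is an uncrossing of [B `|` Z] with [B] and that
    point, whose intersection [B] has order exactly [n]. Limit-closedness supplies
    the chain condition of Zorn's lemma, so a maximal [Z] inside [Y] exists, and
    it exhausts [Y]. *)
Lemma absorb (B : set I) : g B = n%:Z%:E ->
  (forall x, ~ B x -> g (B `|` [set x]) <= n%:Z%:E) ->
  forall Y, B `<=` Y -> g Y <= n%:Z%:E.
Proof.
move=> gB gB1 Y BY.
pose good (Z : set I) := Z `<=` Y /\ g (B `|` Z) <= n%:Z%:E.
have [|Z [[ZY gZ] Zmax]] := @Zorn_bigcup I good.
  move=> F Fgood Ftot; split; first by move=> x [Z /Fgood[ZY _] /ZY].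
  have [F0|F0] := pselect (F !=set0); last first.
    (* The empty chain is outside the scope of limit-closedness. *)
    rewrite bigcup0 ?setU0 ?gB// => Z FZ; by case: F0; exists Z.
  rewrite -bigcupUr//.
  rewrite -(bigcup_image F (fun Z => B `|` Z) id).
  apply: lambda_limit.
  - by case: F0 => Z FZ; exists (B `|` Z), Z.
  - move=> _ _ [Z1 F1 <-] [Z2 F2 <-].
    by have [s|s] := Ftot _ _ F1 F2; [left|right]; exact: setUS.
  - by move=> _ [Z /Fgood[_ gZ] <-].
suff -> : Y = B `|` Z by [].
apply/seteqP; split=> [x Yx|x [/BY//|/ZY//]].
apply: contrapT => BZx.
apply: (Zmax (Z `|` [set x])).
  by split=> [z|ZxZ]; [left|apply: BZx; right; apply: ZxZ; right].
split; first by move=> y [/ZY//|->].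
have -> : B `|` (Z `|` [set x]) = (B `|` Z) `|` (B `|` [set x]).
  by rewrite setUACA setUid.
apply: uncrossU => //; first by apply: gB1 => Bx; apply: BZx; left.
suff -> : (B `|` Z) `&` (B `|` [set x]) = B by rewrite gB.
apply/seteqP; split=> [y [[//|Zy] [//|yx]]|y By]; last by split; left.
by case: BZx; right; rewrite -yx.
Qed.

End Uncrossing.

Section Pullback.
Variables (E I : Type) (L : connectivity_system E) (P : I -> set E).
Hypothesis Ppart : partition [set: I] P [set: E].

Lemma petal_inj e i j : P i e -> P j e -> i = j.
Proof. by case: Ppart => _ triv _ Pi Pj; apply: triv => //; exists e. Qed.

(** The contraction of each petal to a point. Since the petals partition the ground
    set, the union of petals commutes with all set operations, and the axioms are
    inherited. *)
Definition petal_system : connectivity_system I.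
Proof.
exists (fun Y => L (petal_union P Y)).
- by move=> Y; exact: lambda_ge0.
- move=> Y; rewrite -[RHS]lambda_setC; congr (L _).
  apply/seteqP; split=> [e [i Yi Pi] [j Yj Pj]|e nYe].
    by apply: Yi; rewrite (petal_inj Pi Pj).
  have [i _ Pi] : cover [set: I] P e by case: Ppart => ->.
  by exists i => // Yi; apply: nYe; exists i.
- move=> A B; rewrite /petal_union bigcup_setU.
  suff -> : \bigcup_(i in A `&` B) P i =
      (\bigcup_(i in A) P i) `&` (\bigcup_(i in B) P i) by exact: lambda_submod.
  apply/seteqP; split=> [e [i [Ai Bi] Pi]|e [[i Ai Pi] [j Bj Pj]]].
    by split; exists i.
  by exists i => //; split=> //; rewrite (petal_inj Pi Pj).
- move=> n F [Y0 FY0] Ftot Fn.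
  have -> : petal_union P (\bigcup_(Y in F) Y) =
      \bigcup_(A in petal_union P @` F) A.
    rewrite bigcup_image; apply/seteqP; split.
      by move=> e [i [Y FY Yi] Pi]; exists Y => //; exists i.
    by move=> e [Y FY [i Yi Pi]]; exists i => //; exists Y.
  apply: lambda_limit.
  - by exists (petal_union P Y0), Y0.
  - move=> _ _ [A FA <-] [B FB <-].
    have [AB|BA] := Ftot _ _ FA FB; [left|right]; exact: bigcup_subset.
  - by move=> _ [Y FY <-]; exact: Fn.
Defined.

End Pullback.

(** * Cutting a class at one petal *)

Lemma card_le_injection n (J : Type) : [set: 'I_n] #<= [set: J] ->
  exists e : 'I_n -> J, injective e.
Proof.
have all_in T (x : T) : x \in [set: T] by exact/mem_set.
move=> /card_leP[e]; exists (fun i => val (e (SigSub (all_in _ i)))) => i j.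
move=> /val_inj eij.
have := @inj _ _ _ e _ _ (all_in _ _) (all_in _ _) eij.
by move=> [].
Qed.

Lemma exists_fourth (J : Type) (a b c : J) : [set: 'I_4] #<= [set: J] ->
  exists d, [/\ d <> a, d <> b & d <> c].
Proof.
move=> J4; have [e einj] := card_le_injection J4.
pose s : seq {classic J} := [:: a; b; c].
apply: contrapT => nod.
have es : {subset map (e : 'I_4 -> {classic J}) (enum 'I_4) <= s}.
  move=> d _; apply/negPn/negP => /negP ds; apply: nod; exists d.
  by split=> dE; apply: ds; rewrite dE !in_cons eqxx ?orbT.
have := uniq_leq_size _ es.
by rewrite map_inj_uniq ?enum_uniq// => /(_ isT); rewrite size_map size_enum_ord.
Qed.

Section OneSide.
Variables (I J : Type) (g : connectivity_system I) (n : nat).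
Variables (C : cyclic_order I) (f : I -> J).
Hypothesis f_surj : forall j, exists i, f i = j.
Hypothesis f_fiber : forall j, cyc_interval C (f @^-1` [set j]).
Hypothesis g_interval : forall Y, cyc_interval C Y -> (g Y <= n%:Z%:E)%E.
Hypothesis g_saturated : forall W, nontrivial_subset W ->
  g (f @^-1` W) = n%:Z%:E.
Hypothesis J4 : [set: 'I_4] #<= [set: J].

(** One of the two arcs into which [x] divides its fiber. The description mentions
    no point outside the fiber, so that arcs obtained from intervals with
    different far ends are literally the same set. *)
Definition fiber_arc x : set I :=
  [set z | f z = f x /\ forall w, C x w z -> f w = f x].

(** The classes met from [x] up to the far end of the fiber of [m]. An infinite fiber
    need not have a last point, hence the quantification over [z]. *)
Definition swept x m : set J :=
  [set c | c <> f x /\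
    exists y z, [/\ f y = c, f z = m & y = z \/ C x y z]].

Lemma nontrivial_witness (W : set J) a b : W a -> ~ W b -> nontrivial_subset W.
Proof. by move=> Wa Wb; split=> W0; [rewrite W0 in Wa|apply: Wb; rewrite W0]. Qed.

Lemma fiber_convex x u w v : f u <> f x -> f u = f v ->
  C x u w -> C x w v -> f w = f v.
Proof.
move=> ux uv; apply: (@interval_convex _ C (f @^-1` [set f v])) => //=.
by rewrite -uv => /esym.
Qed.

(** This set is an initial segment from [x]. Beyond the fiber of [x], a point [w]
    that precedes a point [v] of a swept class is itself in a swept class: else
    the fiber of [v] would surround a point of the fiber of [m]. *)
Lemma swept_interval x m : m <> f x ->
  cyc_interval C (f @^-1` swept x m `|` fiber_arc x).
Proof.
move=> mx; apply: (@initial_segment_interval _ _ x).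
  by right; split=> // w xwx; case: (cyc_neq13 xwx).
move=> w v [Tv|[vx xv]] xwv; last first.
  right; split; first exact: xv.
  by move=> u xuw; apply: xv; exact: cyc_trans xwv.
case: Tv => vx [y [z [yv zm yz]]].
have [wx|wx] := pselect (f w = f x).
  right; split=> // u xuw.
  have xw : x <> w by move=> xw; move: xwv; rewrite xw; exact: cyc_neq12.
  have [xwK|wxK] := @f_fiber (f x) x w erefl wx xw; first exact: xwK.
  by case: vx; apply: wxK; exact: cyc_rot.
left; split=> //.
have [vm|vm] := pselect (f v = m); first by exists w, v; split=> //; right.
exists w, z; split=> //.
have [->|wz] := pselect (w = z); [by left|right].
have xw : x <> w by move=> xw; apply: wx; rewrite xw.
have xz : x <> z by move=> xz; apply: mx; rewrite -zm xz.
have [//|zwx] := cyc_total C xw wz xz.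
case: yz => [yz|xyz]; first by case: vm; rewrite -yv yz.
case: vm; rewrite -zm; apply/esym; apply: (fiber_convex _ yv xyz).
  by rewrite yv.
by apply: cyc_trans xwv; exact: cyc_rot2.
Qed.

(** In the order cut open at [x] the fibers of [a] and [b] are disjoint and convex,
    so that one comes entirely before the other. *)
Lemma swept_asym x a b : a <> f x -> b <> f x -> a <> b ->
  swept x a b -> ~ swept x b a.
Proof.
move=> ax bx ab [_ [y [z [yb za yz]]]] [_ [y' [z' [ya' zb' yz']]]].
case: yz => [yz|yz]; first by apply: ab; rewrite -za -yb yz.
case: yz' => [yz'|yz']; first by apply: ab; rewrite -zb' -ya' yz'.
have zz' : z <> z' by move=> zz'; apply: ab; rewrite -za -zb' zz'.
have xz : x <> z by move=> xz; apply: ax; rewrite xz.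
have xz' : x <> z' by move=> xz'; apply: bx; rewrite xz'.
have [c|z'zx] := cyc_total C xz zz' xz'.
  by apply: ab; rewrite -za -zb'; apply: (fiber_convex _ _ yz c); rewrite yb.
apply: ab; apply/esym; rewrite -za -zb'.
by apply: (fiber_convex _ _ yz' (cyc_rot2 z'zx)); rewrite ya'.
Qed.

(** With [T := swept x m], first the fiber of [c] is added to the interval of
    [swept_interval] and then all classes other than [c] are removed from it. The
    class [b], which is never covered, keeps the sets of classes that occur
    non-trivial. *)
Lemma fiber_arc_le_aux x c m b : c <> f x -> m <> f x -> b <> c -> b <> f x ->
  ~ swept x m b -> (g (f @^-1` [set c] `|` fiber_arc x) <= n%:Z%:E)%E.
Proof.
move=> cx mx bc bx Tb.
pose T := swept x m.
have Tm : T m by split=> //; have [z zm] := f_surj m; exists z, z; split=> //; left.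
have Tx : ~ T (f x) by case.
have Xx z : fiber_arc x z -> f z = f x by case.
have gA : (g ((f @^-1` T `|` fiber_arc x) `|` f @^-1` (c |` T)) <= n%:Z%:E)%E.
  apply: uncrossU; first exact/g_interval/swept_interval.
    by rewrite g_saturated//; apply: (@nontrivial_witness _ m b); [right|case].
  suff -> : (f @^-1` T `|` fiber_arc x) `&` f @^-1` (c |` T) = f @^-1` T.
    by rewrite g_saturated//; apply: (@nontrivial_witness _ m b).
  apply/seteqP; split=> [z [[//|Xz] [/=|//]]|z Tz].
    by rewrite (Xx _ Xz) => /esym.
  by split; [left|right].
have -> : f @^-1` [set c] `|` fiber_arc x =
    ((f @^-1` T `|` fiber_arc x) `|` f @^-1` (c |` T)) `&`
    f @^-1` [set c; f x].
  apply/seteqP; split=> z.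
    case=> [zc|Xz]; first by split; [right; left|left].
    by split; [left; right|right; exact: Xx].
  case=> [[[Tz|Xz]|[zc|Tz]]] [zc'|zx]; try by [left|right]; by rewrite /= zx in Tz.
apply: uncrossI => //.
  by rewrite g_saturated//; apply: (@nontrivial_witness _ c b); [left|case].
suff -> : ((f @^-1` T `|` fiber_arc x) `|` f @^-1` (c |` T)) `|`
    f @^-1` [set c; f x] = f @^-1` (T `|` [set c; f x]).
  rewrite g_saturated//; apply: (@nontrivial_witness _ m b); first by left.
  by case=> [//|[//|//]].
apply/seteqP; split=> z.
  by move=> [[[?|/Xx ?]|[?|?]]|[?|?]]; [left|right; right|right; left|left|right; left|right; right].
by move=> [?|[?|?]]; [left; left; left|right; left|right; right].
Qed.

(** Of two further classes, the one met first from [x] serves as far end, and the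
    other one remains uncovered. *)
Lemma fiber_arc_le x c : c <> f x ->
  (g (f @^-1` [set c] `|` fiber_arc x) <= n%:Z%:E)%E.
Proof.
move=> cx.
have [a [ac ax _]] := exists_fourth c (f x) (f x) J4.
have [b [bc bx ba]] := exists_fourth c (f x) a J4.
have [Tab|Tab] := pselect (swept x a b).
  apply: (@fiber_arc_le_aux _ _ b a) => //.
  by apply: swept_asym => // ab; apply: ba.
exact: (@fiber_arc_le_aux _ _ a b).
Qed.

End OneSide.

(** * Absorbing and counting *)

Section Main.
Variables (I J : Type) (g : connectivity_system I) (n : nat).
Variables (C : cyclic_order I) (f : I -> J).
Hypothesis f_surj : forall j, exists i, f i = j.
Hypothesis f_fiber : forall j, cyc_interval C (f @^-1` [set j]).
Hypothesis g_interval : forall Y, cyc_interval C Y -> (g Y <= n%:Z%:E)%E.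
Hypothesis g_saturated : forall W, nontrivial_subset W ->
  g (f @^-1` W) = n%:Z%:E.
Hypothesis J4 : [set: 'I_4] #<= [set: J].

(** The two arcs at [x] meet in [x] and cover its fiber. Their intersection is no
    larger because some point, in the fiber of [c], lies outside the fiber. *)
Lemma fiber_petal_le x c : c <> f x ->
  (g (f @^-1` [set c] `|` [set x]) <= n%:Z%:E)%E.
Proof.
move=> cx.
pose X := fiber_arc C f x; pose X' := fiber_arc (cyc_rev C) f x.
have gX : (g (f @^-1` [set c] `|` X) <= n%:Z%:E)%E by exact: fiber_arc_le.
have gX' : (g (f @^-1` [set c] `|` X') <= n%:Z%:E)%E.
  apply: fiber_arc_le => //; first by move=> j; exact/cyc_interval_revr.
  by move=> Y /cyc_interval_rev; exact: g_interval.
have XIX' : X `&` X' = [set x].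
  apply/seteqP; split=> [z [[zx xz] [_ zx']]|_ ->]; last first.
    by split; split=> // w xwx; case: (cyc_neq13 xwx).
  apply: contrapT => nzx; have [i ic] := f_surj c.
  have xi : x <> i by move=> xi; apply: cx; rewrite -ic xi.
  have iz : i <> z by move=> iz; apply: cx; rewrite -ic iz.
  apply: cx; rewrite -ic.
  by have [/xz|/zx'] := cyc_total C xi iz (fun e => nzx (esym e)).
have XUX' : X `|` X' = f @^-1` [set f x].
  apply/seteqP; split=> [z [[]|[]]//|z zx].
  have [<-|xz] := pselect (x = z); first by left; split=> // w xwx; case: (cyc_neq13 xwx).
  by have [h|h] := @f_fiber (f x) x z erefl zx xz; [left|right].
rewrite -XIX' setUIr; apply: uncrossI => //.
rewrite setUACA setUid XUX' -preimage_setU g_saturated//.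
have [b [bc bx _]] := exists_fourth c (f x) (f x) J4.
by apply: (@nontrivial_witness _ _ c b); [left|case].
Qed.

Lemma superset_fiber_le c Y : f @^-1` [set c] `<=` Y -> (g Y <= n%:Z%:E)%E.
Proof.
apply: absorb => [|x xc]; last by apply: fiber_petal_le => /esym.
rewrite g_saturated//.
have [b [bc _ _]] := exists_fourth c c c J4.
by apply: (@nontrivial_witness _ _ c b).
Qed.

Lemma avoid_fiber_le c Y : (forall z, Y z -> f z <> c) -> (g Y <= n%:Z%:E)%E.
Proof.
move=> Yc; rewrite -lambda_setC; apply: (@superset_fiber_le c) => z /= zc Yz.
exact: Yc Yz zc.
Qed.

(** The parts [Y `&` f @^-1` S m] of a set [Y] of order more than [n] have order at
    least [m]; [m = n.+1] leaves the fiber of the last class of [e] untouched. *)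
Lemma all_unions_le : [set: 'I_n.+2] #<= [set: J] ->
  forall Y, (g Y <= n%:Z%:E)%E.
Proof.
move=> Jn Y; have [e einj] := card_le_injection Jn; apply/idPn => gY.
pose S m : set J := [set e i | i in [set i : 'I_n.+2 | (i < m)%N]].
have grow m : (m <= n.+2)%N -> (m%:Z%:E <= g (Y `&` f @^-1` S m))%E.
  elim: m => [_|m IH mn]; first exact: lambda_ge0.
  pose c := e (Ordinal mn).
  apply: (@submod_step _ g n m _ (Y `&` ~` (f @^-1` [set c]))).
  - suff -> : (Y `&` f @^-1` S m.+1) `|` (Y `&` ~` (f @^-1` [set c])) = Y by [].
    rewrite -setIUr; apply/seteqP; split=> [z []//|z Yz]; split=> //.
    have [zc|zc] := pselect (f z = c); [left|by right].
    by exists (Ordinal mn) => //=; exact: ltnSn.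
  - by apply: (@avoid_fiber_le c) => z [].
  - suff -> : (Y `&` f @^-1` S m.+1) `&` (Y `&` ~` (f @^-1` [set c])) =
        Y `&` f @^-1` S m by apply/IH/ltnW.
    apply/seteqP; split=> [z [[Yz [i im iz]] [_ zc]]|z [Yz [i im iz]]].
      split=> //; exists i => //=; rewrite ltn_neqAle -ltnS im andbT.
      by apply/eqP => im'; apply: zc; rewrite /= -iz; congr e; exact: val_inj.
    split; split=> //; first by exists i => //=; exact: ltnW.
    rewrite /= -iz => /einj ic; by rewrite ic /= ltnn in im.
have := grow n.+1 (leqnSn _); apply/negP; rewrite -ltNge.
apply: (@le_lt_trans _ _ (n%:Z%:E)); last by rewrite lte_fin; lia.
apply: (@avoid_fiber_le (e ord_max)) => z [_ [i im <-]] /einj ic.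
by rewrite ic /= ltnn in im.
Qed.

End Main.

Theorem theorem4p6 (E : Type) (L : connectivity_system E) (k : nat)
  (I : Type) (C : cyclic_order I) (P : I -> set E)
  (J : Type) (D : cyclic_order J) (Q : J -> set E) :
  pseudoflower L k C P ->
  concatenation L k C P D Q ->
  finite_anemone L k D Q ->
  [set: 'I_k.+1] #<= [set: J] ->
  strong_pseudoanemone L k C P.
Proof.
move=> Pflower [_ [Qpart _] [f [Pf f_int]]] [[_ J4 _] _ gQ] Jk.
split=> //; case: Pflower => Ppart gP.
case: k gP gQ Jk => [|n] gP gQ Jk.
  (* For k = 0 the whole ground set would have negative order. *)
  have := gP setT (fun x z _ _ _ => or_introl (@subsetT _ _)).
  by move=> /(le_trans (lambda_ge0 _ _)).
have kn : (n.+1%:Z - 1 = n%:Z)%R by lia.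
rewrite kn in gP gQ *.
have Qf W : petal_union Q W = petal_union P (f @^-1` W).
  apply/seteqP; split=> [e [j Wj Qj]|e [i Wi Pi]]; last first.
    by exists (f i) => //; exact: Pf.
  have [i _ Pi] : cover [set: I] P e by case: Ppart => ->.
  by exists i => //=; rewrite (petal_inj Qpart (Pf _ _ Pi) Qj).
have f_surj j : exists i, f i = j.
  have [e Qj] : Q j !=set0 by case: Qpart => _ _; exact.
  have : petal_union Q [set j] e by exists j.
  by rewrite Qf => -[i ij _]; exists i.
apply: (@all_unions_le I J (petal_system L Ppart) n C f) => //.
- by move=> j; apply: f_int => x z -> ->.
- by move=> W Wnt; rewrite /= -Qf; exact: gQ.
Qed.
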